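(* Let $\beta=({}_SA,B_S)$ be a dual pair over a semigroup $S$ with weak local units. Then $\Sigma^\beta=\Omega_1^\beta$.
   Context: A left $S$-act ${}_SA$ is a set $A$ with a map $S\times A\to A$ satisfying $(st)a=s(ta)$; right acts are defined dually. $\mathrm{End}({}_SA)$ and $\mathrm{End}(B_S)$ denote the sets of act endomorphisms (maps preserving the action). A semigroup $S$ has weak local units if for every $s\in S$ there exist $u,v\in S$ such that $us=s=sv$. A pair $\beta=({}_SA,B_S)$ over $S$ consists of a left act ${}_SA$, a right act $B_S$ and an $(S,S)$-biact morphism $\langle\,,\rangle:{}_SA\times B_S\to{}_SS_S$, i.e. $\langle sa,b\rangle=s\langle a,b\rangle$ and $\langle a,bs\rangle=\langle a,b\rangle s$. The pair is dual if (1) for every $a\in A$ there exists $a'\in A$ with $a\in Sa'$ and $\langle a',B\rangle=S$; and (2) for every $b\in B$ there exists $b'\in B$ with $b\in b'S$ and $\langle A,b'\rangle=S$. Define $$\Omega^\beta=\{(\rho,\sigma)\mid\rho\in\mathrm{End}({}_SA),\ \sigma\in\mathrm{End}(B_S),\ \langle\rho(a),b\rangle=\langle a,\sigma(b)\rangle\text{ for all }a\in A,\ b\in B\},$$ $$\Omega_1^\beta=\{(\rho,\sigma)\in\Omega^\beta\mid\exists a\in A,\ \exists b\in B:\ \rho(A)\subseteq Sa\text{ and }\sigma(B)\subseteq bS\},$$ $$\Sigma^\beta=\{(\rho,\sigma)\in\Omega^\beta\mid\exists b\in B,\ \exists a\in A:\ \rho=\langle -,b\rangle a\text{ and }\sigma=b\langle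 a,-\rangle\}.$$ *)

(* Defs.v *)
From mathcomp Require Import all_boot.
From mathcomp Require Import boolp classical_sets.

Set Implicit Arguments.
Unset Strict Implicit.
Unset Printing Implicit Defensive.

Local Open Scope group_scope.
Local Open Scope classical_set_scope.

Declare Scope act_scope.
Delimit Scope act_scope with act.
Local Open Scope act_scope.

Definition weak_local_units (S : semigroupType) : Prop :=
  forall s : S, exists u v : S, u * s = s /\ s = s * v.

Record leftAct (S : semigroupType) := LeftAct {
  left_sort :> Type;
  lact : S -> left_sort -> left_sort;
  lactM : forall (s t : S) (a : left_sort), lact (s * t) a = lact s (lact t a)
}.

Record rightAct (S : semigroupType) := RightAct {
  right_sort :> Type;
  ract : right_sort -> S -> right_sort;
  ractM : forall (b : right_sort) (s t : S), ract b (s * t) = ract (ract b s) t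
}.

Notation "s *> a" := (lact s a) (at level 40, left associativity) : act_scope.
Notation "b <* s" := (ract b s) (at level 40, left associativity) : act_scope.

Definition left_end (S : semigroupType) (A : leftAct S) : set (A -> A) :=
  [set rho | forall (s : S) (a : A), rho (s *> a) = s *> rho a].

Definition right_end (S : semigroupType) (B : rightAct S) : set (B -> B) :=
  [set sigma | forall (b : B) (s : S), sigma (b <* s) = sigma b <* s].

Arguments left_end {S} A _.
Arguments right_end {S} B _.

(* The orbits are S a and b S, not S^1 a and b S^1: a need not lie in S a. *)
Definition left_orbit (S : semigroupType) (A : leftAct S) (a : A) : set A :=
  range (fun s : S => s *> a).

Definition right_orbit (S : semigroupType) (B : rightAct S) (b : B) : set B :=
  range (fun s : S => b <* s).

Record actPair (S : semigroupType) := ActPair {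
  lpart : leftAct S;
  rpart : rightAct S;
  pairing : lpart -> rpart -> S;
  pairingMl : forall (s : S) (a : lpart) (b : rpart),
    pairing (s *> a) b = s * pairing a b;
  pairingMr : forall (a : lpart) (b : rpart) (s : S),
    pairing a (b <* s) = pairing a b * s
}.

Arguments pairing {S} beta a b : rename.

Section Pairs.
Variables (S : semigroupType) (beta : actPair S).
Let A : leftAct S := lpart beta.
Let B : rightAct S := rpart beta.

Definition dual_pair : Prop :=
  (forall a : A, exists a' : A,
     left_orbit a' a /\ range (fun b : B => pairing beta a' b) = [set: S]) /\
  (forall b : B, exists b' : B,
     right_orbit b' b /\ range (fun a : A => pairing beta a b') = [set: S]).

Definition Omega : set ((A -> A) * (B -> B)) :=
  [set f | [/\ left_end A f.1, right_end B f.2 &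
     forall (a : A) (b : B), pairing beta (f.1 a) b = pairing beta a (f.2 b)]].

Definition Omega1 : set ((A -> A) * (B -> B)) :=
  [set f | Omega f /\ exists (a : A) (b : B),
     range f.1 `<=` left_orbit a /\ range f.2 `<=` right_orbit b].

Definition Sigma : set ((A -> A) * (B -> B)) :=
  [set f | Omega f /\ exists (b : B) (a : A),
     f.1 = (fun x : A => pairing beta x b *> a) /\
     f.2 = (fun y : B => b <* pairing beta a y)].

End Pairs.

Arguments Omega {S} beta _.
Arguments Omega1 {S} beta _.
Arguments Sigma {S} beta _.

(* Main.v *)
Require Import Defs.
From mathcomp Require Import all_boot.
From mathcomp Require Import boolp classical_sets.

(** Let [(rho, sigma)] be in [Omega1].  By duality one may assume that
    [rho(A) <= S a] and [sigma(B) <= b S] with [<a, B> = S = <A, b>].  Write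
    [a = v d] and choose [y] with [<a, y> = v].  If [rho x = s a], then
    [rho x = s <a, y> d = <rho x, y> d = <x, sigma y> d], so [rho = <-, c> d]
    with [c = sigma y].  Moreover [sigma z] and [c <d, z>] both lie in [b S] and
    pair equally with every [x], and [<A, b> = S] makes the elements of [b S]
    separated by [A]; hence [sigma = c <d, ->]. *)

Set Implicit Arguments.
Unset Strict Implicit.

Local Open Scope group_scope.
Local Open Scope classical_set_scope.
Local Open Scope act_scope.

Lemma left_orbit_sub (S : semigroupType) (A : leftAct S) (a a' : A) :
  left_orbit a' a -> left_orbit a `<=` left_orbit a'.
Proof. by case=> t _ <- _ [s _ <-]; exists (s * t) => //; rewrite lactM. Qed.

Lemma right_orbit_sub (S : semigroupType) (B : rightAct S) (b b' : B) :
  right_orbit b' b -> right_orbit b `<=` right_orbit b'.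
Proof. by case=> t _ <- _ [s _ <-]; exists (t * s) => //; rewrite ractM. Qed.

Lemma Sigma_sub_Omega1 (S : semigroupType) (beta : actPair S) :
  Sigma beta `<=` Omega1 beta.
Proof.
move=> [rho sigma] [Ors [b [a /= [rhoE sigmaE]]]]; split=> //; exists a, b.
split=> [_ [x _ <-]|_ [y _ <-]] /=.
- by rewrite rhoE; exists (pairing beta x b).
- by rewrite sigmaE; exists (pairing beta a y).
Qed.

(** Write [y = b s], [z = b t], [b = b' w] and choose [x] with [<x, b> = w]: then [w s = w t], so
    [b' w s = b' w t]. *)
Lemma right_orbit_separated (S : semigroupType) (beta : actPair S)
    (b y z : rpart beta) :
  dual_pair beta -> range (fun x => pairing beta x b) = [set: S] ->
  right_orbit b y -> right_orbit b z ->
  (forall x, pairing beta x y = pairing beta x z) -> y = z.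
Proof.
move=> [_ dualB] bS [s _ <-] [t _ <-] eq_st.
have [b' [[w _ b'w] _]] := dualB b.
have [x _ xb] : range (fun x => pairing beta x b) w by rewrite bS.
have := eq_st x; rewrite !pairingMr xb => wst.
by rewrite -b'w -!ractM wst.
Qed.

Lemma Omega1_sub_Sigma (S : semigroupType) (beta : actPair S) :
  dual_pair beta -> Omega1 beta `<=` Sigma beta.
Proof.
move=> dual [rho sigma] [Ors [a0 [b0 /= [rhoa0 sigmab0]]]]; split=> //.
have [dualA dualB] := dual; have [_ /= sigmaM adj] := Ors.
have [a [a0a aS]] := dualA a0; have [b [b0b bS]] := dualB b0.
(* Duality again, now at [a], gives [a = v d]; surjectivity of [<a, ->] then realises [v] as a
   pairing value. *)
have [d [[v _ dv] _]] := dualA a.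
have [y _ ay] : range (fun y => pairing beta a y) v by rewrite aS.
have rhoE x : rho x = pairing beta x (sigma y) *> d.
  have [s _ sa] : left_orbit a (rho x).
    by apply: (left_orbit_sub a0a); apply: rhoa0; exists x.
  by rewrite -adj /= -sa pairingMl ay lactM dv.
have sigmab z : right_orbit b (sigma z).
  by apply: (right_orbit_sub b0b); apply: sigmab0; exists z.
exists (sigma y), d; split; apply/funext => z //=.
(* Here [sigma y <d, z> = sigma (y <d, z>)] lies in [b S], and both sides pair with [x] to
   [<rho x, z>]. *)
apply: (right_orbit_separated dual bS) => // [|x].
- by rewrite -sigmaM.
- by rewrite pairingMr -pairingMl -rhoE adj.
Qed.

Theorem theorem3p5 (S : semigroupType) (beta : actPair S)
  (hS : weak_local_units S) (hbeta : dual_pair beta) :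
  Sigma beta = Omega1 beta.
Proof.
apply/seteqP; split; first exact: Sigma_sub_Omega1.
exact: Omega1_sub_Sigma.
Qed.
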